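(* For every problem instance with identical task weights ($w_1=\dots=w_n$) we have $$\max_{N\in\mathcal{N}} C(N)\;\le\;\frac{4}{3}\,\min_{N\in\mathcal{N}} C(N),$$ where $\mathcal{N}$ is the set of all Nash assignments of the instance.
   Context: A problem instance $(T,R)$ consists of a set $R=\{1,\dots,m\}$ of resources with delays (positive reals) $d_1\le\dots\le d_m$ and a set $T=\{1,\dots,n\}$ of tasks with real weights $w_1,\dots,w_n\ge 1$. An assignment is a vector $A=(A_1,\dots,A_n)\in\{1,\dots,m\}^n$ (task $i$ is assigned to resource $A_i$). The load of resource $\ell$ in $A$ is $L(\ell,A)=d_\ell\sum_{i\in T:\,A_i=\ell}w_i$, the load of task $i$ is $L(A_i,A)$, and the social cost is $C(A)=\sum_{i\in T}L(A_i,A)$. An assignment $A$ is a Nash assignment if for every task $i$ and every resource $\ell$ we have $L(A_i,A)\le L(\ell,A')$, where $A'$ is obtained from $A$ by re-assigning task $i$ to resource $\ell$ and making no other change. $\mathcal{N}=\mathcal{N}(T,R)$ is the set of all Nash assignments; it is known to be nonempty. *)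

(* Defs.v *)
From mathcomp Require Import all_boot all_order all_algebra reals ring.
Set Implicit Arguments. Unset Strict Implicit. Unset Printing Implicit Defensive.
Import Order.TTheory GRing.Theory Num.Theory.
Local Open Scope ring_scope.

(* Resources are 'I_m and tasks are 'I_n (so indices start at 0). *)
Record instance (R : realType) (m n : nat) := Instance {
  resources_gt0 : (0 < m)%N;
  delay : 'I_m -> R;
  delay_gt0 : forall l, 0 < delay l;
  delay_sorted : forall k l : 'I_m, (k <= l)%N -> delay k <= delay l;
  weight : 'I_n -> R;
  weight_ge1 : forall i, 1 <= weight i
}.

Definition identical_weights (R : realType) (m n : nat) (I : instance R m n) :=
  forall i j, weight I i = weight I j.

Definition assignment (m n : nat) := {ffun 'I_n -> 'I_m}.

Definition reassign (m n : nat) (A : assignment m n) (i : 'I_n) (l : 'I_m) :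
    assignment m n :=
  [ffun j => if j == i then l else A j].

Definition load (R : realType) (m n : nat) (I : instance R m n) (l : 'I_m)
    (A : assignment m n) : R :=
  delay I l * \sum_(i < n | A i == l) weight I i.

Definition social_cost (R : realType) (m n : nat) (I : instance R m n)
    (A : assignment m n) : R :=
  \sum_(i < n) load I (A i) A.

Definition nash (R : realType) (m n : nat) (I : instance R m n) :
    pred (assignment m n) :=
  fun A => [forall i, forall l, load I (A i) A <= load I l (reassign A i l)].

(* Moving task i from resource a to resource b changes this potential by
   2 * w_i * (new load of b - old load of a), so its minimizers are Nash. *)
Definition potential (R : realType) (m n : nat) (I : instance R m n)
    (A : assignment m n) : R :=
  \sum_(l < m) delay I l * (\sum_(i < n | A i == l) weight I i) ^+ 2 +
  \sum_(i < n) delay I (A i) * weight I i ^+ 2.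

Lemma potential_reassign (R : realType) (m n : nat) (I : instance R m n)
    (A : assignment m n) (i : 'I_n) (b : 'I_m) : A i != b ->
  potential I (reassign A i b) - potential I A =
  2 * weight I i * (load I b (reassign A i b) - load I (A i) A).
Proof.
move=> neq; rewrite /potential /load.
set A' := reassign A i b.
have Ai' : A' i = b by rewrite ffunE eqxx.
have Aj j : j != i -> A' j = A j by rewrite ffunE => /negbTE ->.
pose S l := \sum_(j < n | (A j == l) && (j != i)) weight I j.
have S' l : \sum_(j < n | (A' j == l) && (j != i)) weight I j = S l.
  by apply: eq_bigl => j; case: (eqVneq j i) => [_|/Aj ->]; rewrite ?andbF.
have WA : \sum_(j < n | A j == A i) weight I j = weight I i + S (A i).
  by rewrite (bigD1 i).
have WA'b : \sum_(j < n | A' j == b) weight I j = weight I i + S b.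
  by rewrite (bigD1 i) /= ?Ai' // S'.
have WAo l : A i != l -> \sum_(j < n | A j == l) weight I j = S l.
  move=> h; apply: eq_bigl => j; case: (eqVneq j i) => [->|_]; last by rewrite andbT.
  by rewrite andbF (negbTE h).
have WA'o l : b != l -> \sum_(j < n | A' j == l) weight I j = S l.
  move=> h; rewrite -S'; apply: eq_bigl => j.
  case: (eqVneq j i) => [->|_]; last by rewrite andbT.
  by rewrite andbF Ai' (negbTE h).
rewrite (bigD1 (A i)) //= (bigD1 b) 1?eq_sym //=.
rewrite [\sum_(l < m) delay I l * _](bigD1 (A i)) //=.
rewrite [\sum_(l < m | l != A i) delay I l * (\sum_(j < n | A j == l) _) ^+ 2](bigD1 b) 1?eq_sym //=.
rewrite [\sum_(j < n) delay I (A' j) * _](bigD1 i) //=.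
rewrite [\sum_(j < n) delay I (A j) * _](bigD1 i) //=.
rewrite WA WA'b (WAo b) // (WA'o (A i)) 1?eq_sym // Ai'.
have -> : \sum_(l < m | (l != A i) && (l != b))
    delay I l * (\sum_(j < n | A' j == l) weight I j) ^+ 2 =
  \sum_(l < m | (l != A i) && (l != b))
    delay I l * (\sum_(j < n | A j == l) weight I j) ^+ 2.
  by apply: eq_bigr => l /andP[h1 h2]; rewrite WAo ?WA'o // eq_sym.
have -> : \sum_(j < n | j != i) delay I (A' j) * weight I j ^+ 2 =
  \sum_(j < n | j != i) delay I (A j) * weight I j ^+ 2.
  by apply: eq_bigr => j /Aj ->.
ring.
Qed.

Lemma nash_exists (R : realType) (m n : nat) (I : instance R m n) :
  exists A, nash I A.
Proof.
pose A0 : assignment m n := [ffun=> Ordinal (resources_gt0 I)].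
case: (@Order.TotalTheory.arg_minP _ _ _ A0 predT (potential I)) => // A _ minA.
exists A; apply/forallP => i; apply/forallP => l.
have [Ail|neq] := eqVneq (A i) l.
  suff -> : reassign A i l = A by rewrite Ail.
  by apply/ffunP => j; rewrite ffunE; case: eqVneq => // ->.
have := minA (reassign A i l) isT.
rewrite -subr_ge0 potential_reassign // pmulr_rge0 ?subr_ge0 //.
by rewrite mulr_gt0 // (lt_le_trans ltr01) // weight_ge1.
Qed.

Definition some_nash (R : realType) (m n : nat) (I : instance R m n) :
    assignment m n := xchoose (nash_exists I).

(* some_nash only witnesses nonemptiness for arg max / arg min. *)
Definition max_nash_cost (R : realType) (m n : nat) (I : instance R m n) : R :=
  social_cost I [arg max_(A > some_nash I | nash I A) social_cost I A]%O.

Definition min_nash_cost (R : realType) (m n : nat) (I : instance R m n) : R :=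
  social_cost I [arg min_(A < some_nash I | nash I A) social_cost I A]%O.

Lemma max_nash_costP (R : realType) (m n : nat) (I : instance R m n) :
  (exists2 A, nash I A & social_cost I A = max_nash_cost I) /\
  (forall A, nash I A -> social_cost I A <= max_nash_cost I).
Proof.
rewrite /max_nash_cost; case: Order.TotalTheory.arg_maxP => [|A nA maxA].
  exact: (xchooseP (nash_exists I)).
by split; [exists A | exact: maxA].
Qed.

Lemma min_nash_costP (R : realType) (m n : nat) (I : instance R m n) :
  (exists2 A, nash I A & social_cost I A = min_nash_cost I) /\
  (forall A, nash I A -> min_nash_cost I <= social_cost I A).
Proof.
rewrite /min_nash_cost; case: Order.TotalTheory.arg_minP => [|A nA minA].
  exact: (xchooseP (nash_exists I)).
by split; [exists A | exact: minA].
Qed.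

(* Main.v *)
Require Import Defs.
From mathcomp Require Import all_boot all_order all_algebra reals.
From mathcomp Require Import zify lra.
Set Implicit Arguments. Unset Strict Implicit. Unset Printing Implicit Defensive.
Import Order.TTheory GRing.Theory Num.Theory.
Local Open Scope ring_scope.

(** With common weight w put q_l = d_l w, so that an assignment placing a_l
    tasks on resource l has cost \sum_l q_l a_l^2.  If it is Nash, its maximal
    load t satisfies q_l a_l <= t <= q_l (a_l + 1) for all l.  Given two Nash
    assignments with counts a, b and levels t, t', t < t' would force a <= b
    pointwise, hence a = b since both count all the tasks.  If t = t', then
    a_l and b_l differ by at most one, and when they differ the larger one is
    t / q_l; this gives q_l a_l^2 - 4/3 q_l b_l^2 <= 4/3 t (a_l - b_l), whose
    right-hand side sums to 0. *)

Definition task_count (m n : nat) (A : assignment m n) (l : 'I_m) : nat :=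
  #|[pred i | A i == l]|.

Lemma sum_task_count (m n : nat) (A : assignment m n) :
  (\sum_(l < m) task_count A l = n)%N.
Proof.
rewrite -[RHS]card_ord -sum1_card (partition_big A predT) //=.
by apply: eq_bigr => l _; rewrite /task_count -sum1_card.
Qed.

Lemma leq_sum_eq (m : nat) (a b : 'I_m -> nat) :
  (forall l, a l <= b l)%N -> (\sum_(l < m) a l = \sum_(l < m) b l)%N -> a =1 b.
Proof.
move=> leab eqab l; apply/eqP.
(* The equality case of [leqif_sum]: the two sums agree exactly when all summands do. *)
have := leqif_sum (fun (i : 'I_m) (_ : true) => conj (leab i) (erefl (a i == b i))).
by case=> _; rewrite eqab eqxx => /esym/forallP/(_ l).
Qed.

(** Only an upper bound, since the count does not grow when task [i] is already on [l]. *)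
Lemma task_count_reassign (m n : nat) (A : assignment m n) (i : 'I_n) (l : 'I_m) :
  (task_count (reassign A i l) l <= (task_count A l).+1)%N.
Proof.
rewrite /task_count -add1n.
apply: leq_trans (_ : #|[predU1 i & [pred j | A j == l]]| <= _)%N.
  apply/subset_leq_card/subsetP => j; rewrite !inE ffunE.
  by case: (j == i).
by rewrite cardU1 leq_add2r leq_b1.
Qed.

Section LoadLevel.
Variables (R : realType) (m : nat) (q : 'I_m -> R).
Hypothesis q_gt0 : forall l, 0 < q l.

Definition load_level (a : 'I_m -> nat) (t : R) : Prop :=
  forall l, q l * (a l)%:R <= t <= q l * ((a l)%:R + 1).

(** Chaining q_l a_l <= t < u <= q_l (b_l + 1) gives a_l < b_l + 1; the strict step between the
    levels is what removes the off-by-one. *)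
Lemma load_level_lt (a b : 'I_m -> nat) (t u : R) :
  load_level a t -> load_level b u -> t < u -> forall l, (a l <= b l)%N.
Proof.
move=> ta ub tu l; have /andP[qa _] := ta l; have /andP[_ qb] := ub l.
have : q l * (a l)%:R < q l * ((b l)%:R + 1).
  exact: le_lt_trans qa (lt_le_trans tu qb).
by rewrite ltr_pM2l // natr1 ltr_nat ltnS.
Qed.

Lemma load_level_count_close (a b : 'I_m -> nat) (t : R) (l : 'I_m) :
  load_level a t -> load_level b t -> (a l <= (b l).+1)%N.
Proof.
move=> ta tb; have /andP[qa _] := ta l; have /andP[_ qb] := tb l.
by have := le_trans qa qb; rewrite ler_pM2l // natr1 ler_nat.
Qed.

(** Without the linear term the bound can fail on a single resource, for instance when a_l = 1 and
    b_l = 0; that term pays for the failure and cancels over all resources. *)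
Lemma load_level_cost_le (a b : 'I_m -> nat) (t : R) (l : 'I_m) :
  load_level a t -> load_level b t ->
  q l * (a l)%:R ^+ 2 - 4 / 3 * (q l * (b l)%:R ^+ 2) <=
  4 / 3 * t * ((a l)%:R - (b l)%:R).
Proof.
move=> ta tb; have q0 := q_gt0 l.
have ab := load_level_count_close l ta tb.
have ba := load_level_count_close l tb ta.
have /andP[qa aq] := ta l; have /andP[qb bq] := tb l.
have b0 : 0 <= (b l)%:R :> R by [].
have a0 : 0 <= (a l)%:R :> R by [].
have [ltab|ltba|eqab] := ltngtP (a l) (b l).
- have eb : b l = (a l).+1 by lia.
  rewrite eb -natr1 in qb *.
  have -> : t = q l * ((a l)%:R + 1) by apply/le_anti/andP.
  nra.
- have ea : a l = (b l).+1 by lia.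
  rewrite ea -natr1 in qa *.
  have -> : t = q l * ((b l)%:R + 1) by apply/le_anti/andP.
  (* With a_l = b_l + 1 and t = q_l (b_l + 1), the right side minus the left is q_l (b_l - 1)^2 / 3.
     It vanishes at b_l = 1, which is where 4/3 comes from. *)
  have := mulr_ge0 (ltW q0) (sqr_ge0 ((b l)%:R - 1 : R)).
  nra.
- rewrite eqab; have := mulr_ge0 (ltW q0) (sqr_ge0 ((b l)%:R : R)).
  nra.
Qed.

Lemma load_level_sum_cost_le (a b : 'I_m -> nat) (t u : R) :
  load_level a t -> load_level b u ->
  (\sum_(l < m) a l = \sum_(l < m) b l)%N ->
  \sum_(l < m) q l * (a l)%:R ^+ 2 <= 4 / 3 * \sum_(l < m) q l * (b l)%:R ^+ 2.
Proof.
move=> ta ub eqs.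
have same : a =1 b ->
    \sum_(l < m) q l * (a l)%:R ^+ 2 <= 4 / 3 * \sum_(l < m) q l * (b l)%:R ^+ 2.
  move=> eqab; under eq_bigr => l _ do rewrite eqab.
  have : 0 <= \sum_(l < m) q l * (b l)%:R ^+ 2.
    by apply: sumr_ge0 => l _; rewrite mulr_ge0 ?sqr_ge0 // ltW.
  lra.
have [tu|ut|etu] := ltgtP t u.
- exact/same/leq_sum_eq/eqs/(load_level_lt ta ub tu).
- apply: same => l; apply/esym; move: l.
  exact/leq_sum_eq/esym/eqs/(load_level_lt ub ta ut).
rewrite -{u}etu in ub.
rewrite -subr_le0 mulr_sumr -sumrB.
have zero : \sum_(l < m) 4 / 3 * t * ((a l)%:R - (b l)%:R) = 0 :> R.
  by rewrite -mulr_sumr sumrB -!natr_sum eqs subrr mulr0.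
rewrite -[leRHS]zero.
by apply: ler_sum => l _; apply: load_level_cost_le.
Qed.

End LoadLevel.

Section IdenticalWeights.
Variables (R : realType) (m n : nat) (I : instance R m n) (w : R).
Hypothesis weightE : forall i, weight I i = w.

Lemma load_identical (l : 'I_m) (A : assignment m n) :
  load I l A = delay I l * w * (task_count A l)%:R.
Proof.
rewrite /load (eq_bigr (fun=> w)) => [|i _]; last exact: weightE.
by rewrite sumr_const -mulrA mulr_natr.
Qed.

Lemma social_cost_identical (A : assignment m n) :
  social_cost I A = \sum_(l < m) delay I l * w * (task_count A l)%:R ^+ 2.
Proof.
rewrite /social_cost (partition_big A predT) //; apply: eq_bigr => l _.
transitivity (\sum_(i < n | A i == l) load I l A);
  first by apply: eq_bigr => i /eqP ->.
by rewrite sumr_const load_identical expr2 mulrA [RHS]mulr_natr.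
Qed.

(** The level is the load of a most loaded resource [k]; the upper bound holds because a task on [k]
    gains nothing by moving to [l]. *)
Lemma nash_load_level (A : assignment m n) :
  0 < w -> nash I A ->
  exists t, load_level (fun l => delay I l * w) (task_count A) t.
Proof.
move=> w0 nA; pose k0 := Ordinal (resources_gt0 I).
have q0 l : 0 < delay I l * w by rewrite mulr_gt0 ?delay_gt0.
have [k _ maxk] := @Order.TotalTheory.arg_maxP _ _ _ k0 predT (load I ^~ A) isT.
exists (load I k A) => l; apply/andP; split.
  by rewrite -load_identical; apply: maxk.
rewrite load_identical natr1.
(* If [k] is empty there is no task to move, but then the maximal load is 0. *)
have [z|/card_gt0P[i /eqP Aik]] := posnP (task_count A k).
  by rewrite z mulr0 mulr_ge0 // ltW.
have /forallP/(_ i)/forallP/(_ l) := nA.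
rewrite !load_identical Aik => /le_trans; apply.
by rewrite ler_pM2l // ler_nat task_count_reassign.
Qed.

End IdenticalWeights.

Theorem theorem4p7 (R : realType) (m n : nat) (I : instance R m n)
    (hw : identical_weights I) :
  max_nash_cost I <= 4 / 3 * min_nash_cost I.
Proof.
have [w w0 weightE] : exists2 w, 0 < w & forall i, weight I i = w.
  (* With no tasks there is no weight to pick, and any positive [w] serves. *)
  case: n => [|n'] in I hw *; first by exists 1 => // -[].
  exists (weight I ord0) => [|i]; last exact: hw.
  exact: lt_le_trans ltr01 (weight_ge1 _ _).
have [[A nA <-] _] := max_nash_costP I.
have [[B nB <-] _] := min_nash_costP I.
have [t tA] := nash_load_level weightE w0 nA.
have [u uB] := nash_load_level weightE w0 nB.
rewrite !(social_cost_identical weightE).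
apply: load_level_sum_cost_le tA uB _ => [l|]; first by rewrite mulr_gt0 ?delay_gt0.
by rewrite !sum_task_count.
Qed.
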